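(* Let $T$ be a tree on $n$ vertices and let $k\ge 2$ be a natural number. Then $$SW_k(T)=\sum_{e\in E(T)} N_k(T-e).$$
   Context: All graphs are finite, simple and undirected; $n(G)$ denotes the number of vertices of a graph $G$. For a connected graph $G$ and $S\subseteq V(G)$, the Steiner diversity $\delta(S)$ is the minimum number of edges of a connected subgraph of $G$ whose vertex set contains $S$. For a natural number $k\ge 2$ the Steiner $k$-Wiener index of $G$ is $SW_k(G)=\sum_{S\subseteq V(G),\,|S|=k}\delta(S)$. For a tree $T$ and $e\in E(T)$, $T-e$ denotes the graph obtained by removing the edge $e$ from $T$ (keeping all vertices); it is a forest with two connected components. For a forest (acyclic graph) $F$ with $p>1$ connected components $T_1,\ldots,T_p$, define $$N_k(F)=\sum_{\substack{l_1+l_2+\cdots+l_p=k\\ 0\le l_1,\ldots,l_p<k}}\binom{n(T_1)}{l_1}\binom{n(T_2)}{l_2}\cdots\binom{n(T_p)}{l_p},$$ where the sum is over tuples of integers $(l_1,\ldots,l_p)$, $\binom{m}{0}=1$ and $\binom{m}{l}=0$ whenever $m<l$. For a tree $T$ (a forest with one component), $N_k(T)=0$. *)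

(* Defs.v *)
From mathcomp Require Import all_boot.
Set Implicit Arguments.
Unset Strict Implicit.
Unset Printing Implicit Defensive.

Definition simple_graph (V : finType) (e : rel V) : Prop :=
  symmetric e /\ irreflexive e.

Definition edges (V : finType) (e : rel V) : {set {set V}} :=
  [set [set p.1; p.2] | p : V * V & e p.1 p.2].

Definition adj_of (V : finType) (F : {set {set V}}) : rel V :=
  [rel x y | [set x; y] \in F].

(* Used when the edges of [e] lie inside [W], so that walks from [W] stay in [W]. *)
Definition connected_on (V : finType) (e : rel V) (W : {set V}) : bool :=
  (W != set0) && [forall x in W, forall y in W, connect e x y].

(* [ucycle] also accepts the empty sequence and the back-and-forth [:: x; y]
   along an edge, which are not cycles of a simple graph. *)
Definition acyclic (V : finType) (e : rel V) : Prop :=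
  forall c : seq V, 2 < size c -> ~ ucycle e c.

Definition is_tree (V : finType) (e : rel V) : Prop :=
  [/\ simple_graph e, connected_on e [set: V] & acyclic e].

(* A subgraph is a pair H = (vertex set, edge set). *)
Definition subgraph (V : finType) (e : rel V)
    (H : {set V} * {set {set V}}) : bool :=
  (H.2 \subset edges e) && [forall d in H.2, d \subset H.1].

Definition connected_subgraph (V : finType) (e : rel V)
    (H : {set V} * {set {set V}}) : bool :=
  subgraph e H && connected_on (adj_of H.2) H.1.

(* The starting point of the argmin is the graph itself, which is a valid
   candidate exactly when the graph is connected, the only case of interest. *)
Definition steiner (V : finType) (e : rel V) (S : {set V}) : nat :=
  #|[arg min_(H < ([set: V], edges e) |
       connected_subgraph e H && (S \subset H.1)) #|H.2| ].2|.

Definition SW (V : finType) (e : rel V) (k : nat) : nat :=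
  \sum_(S : {set V} | #|S| == k) steiner e S.

Definition del_edge (V : finType) (e : rel V) (d : {set V}) : rel V :=
  [rel x y | e x y && ([set x; y] != d)].

Definition components (V : finType) (e : rel V) : {set {set V}} :=
  equivalence_partition (connect e) [set: V].

Definition component (V : finType) (e : rel V) (i : 'I_#|components e|) : {set V} :=
  enum_val i.

(* The bounds 0 <= l_i < k are carried by the type 'I_k. *)
Definition N (V : finType) (k : nat) (e : rel V) : nat :=
  if 1 < #|components e| then
    \sum_(l : {ffun 'I_#|components e| -> 'I_k} |
           \sum_(i < #|components e|) l i == k)
      \prod_(i < #|components e|) 'C(#|component i|, l i)
  else 0.

(* Main.v *)
Require Import Defs.
From mathcomp Require Import all_boot.

(** Both sides count the pairs (S, d) in which S is a k-set of vertices and d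
    is an edge of the tree that separates S, in the sense that S meets both
    components of T - d.

    For a fixed S, the edges of a smallest connected subgraph H containing S
    are exactly the edges separating S ([steiner_tree]).  An edge d separating
    S lies in H, since otherwise H would be connected in T - d.  Conversely,
    suppose that d = xy is an edge of H and S lies in the component C of x in
    T - d.  As a tree has no cycle, d is a bridge, so y is not in C, and the
    map fixing C pointwise and collapsing everything else to x sends walks of
    H to walks of H inside C.  Hence H restricted to C is a connected subgraph
    that contains S and has fewer edges, against the choice of H.

    For a fixed d, N_k(T - d) counts the k-sets separated by d: grouping the
    k-sets by the sizes l_i of their intersections with the components gives
    the product of binomials ([card_profile]), and the condition l_i < k says
    that no single component contains the whole set.  This holds for the
    components of any undirected graph ([N_separated]). *)

Set Implicit Arguments.
Unset Strict Implicit.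
Unset Printing Implicit Defensive.

(** * Separated sets *)

(** Some two vertices of [S] lie in different components of [e]. *)
Definition separated (V : finType) (e : rel V) (S : {set V}) : bool :=
  [exists x in S, exists y in S, ~~ connect e x y].

Lemma separatedPn (V : finType) (e : rel V) (S : {set V}) :
  reflect {in S &, forall x y, connect e x y} (~~ separated e S).
Proof.
apply: (iffP idP) => [nsep x y xS yS | conS].
  apply: contraNT nsep => nxy.
  by apply/existsP; exists x; rewrite xS; apply/existsP; exists y; rewrite yS.
apply/negP => /existsP[x /andP[xS /existsP[y /andP[yS]]]].
by rewrite conS.
Qed.

Lemma set2_eq (V : finType) (a b x y : V) :
  [set a; b] = [set x; y] -> (a = x /\ b = y) \/ (a = y /\ b = x).
Proof.
move=> E.
have: a \in [set x; y] by rewrite -E set21.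
have: b \in [set x; y] by rewrite -E set22.
have: x \in [set a; b] by rewrite E set21.
have: y \in [set a; b] by rewrite E set22.
rewrite !inE => /orP[]/eqP-> /orP[]/eqP-> /orP[]/eqP Hb /orP[]/eqP Ha;
  by [left | right | left; split; congruence | right; split; congruence].
Qed.

(** * Counting sets by their intersections with the classes of a partition *)

Section Profile.

(* The classes of the partition are the fibres of [c]. *)
Variables (V I : finType) (c : V -> I).

Let fibre (i : I) : {set V} := [set x | c x == i].

Lemma sum_card_fibre (S : {set V}) : \sum_i #|S :&: fibre i| = #|S|.
Proof.
rewrite -sum1_card (partition_big c predT) //=.
apply: eq_bigr => i _; rewrite -sum1_card; apply: eq_bigl => x.
by rewrite !inE.
Qed.

Lemma card_profile (l : I -> nat) :
  #|[set S : {set V} | [forall i, #|S :&: fibre i| == l i]]|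
    = \prod_i 'C(#|fibre i|, l i).
Proof.
pose Q i := [set A : {set V} | A \subset fibre i & #|A| == l i].
under eq_bigr => i _ do rewrite -cards_draws -/(Q i).
transitivity #|family (fun i => mem (Q i))|; last first.
  by rewrite card_family foldrE big_image.
pose split (S : {set V}) := [ffun i => S :&: fibre i].
have split_inj : injective split.
  move=> S S' /ffunP E; apply/setP => x.
  by move: (E (c x)); rewrite !ffunE => /setP/(_ x); rewrite !inE eqxx !andbT.
rewrite -(card_imset _ split_inj); apply: eq_card => f.
apply/imsetP/familyP => [[S] | famf].
  rewrite inE => /forallP HS -> i.
  by rewrite inE ffunE subsetIr HS.
have cutf i : (\bigcup_j f j) :&: fibre i = f i.
  apply/setP => x; rewrite !inE; apply/andP/idP.
    case=> /bigcupP[j _ xj] /eqP <-.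
    have := famf j; rewrite inE => /andP[/subsetP/(_ x xj)].
    by rewrite inE => /eqP->.
  move=> xi; split; first by apply/bigcupP; exists i.
  by have := famf i; rewrite inE => /andP[/subsetP/(_ x xi)]; rewrite inE.
exists (\bigcup_j f j); last by apply/ffunP => i; rewrite ffunE cutf.
rewrite inE; apply/forallP => i; rewrite cutf.
by have := famf i; rewrite inE => /andP[].
Qed.

Lemma sum_profiles (k : nat) :
  \sum_(l : {ffun I -> 'I_k} | \sum_i l i == k) \prod_i 'C(#|fibre i|, l i)
    = #|[set S : {set V} | (#|S| == k) && [forall i, #|S :&: fibre i| < k]]|.
Proof.
under eq_bigr => l _ do rewrite -card_profile -sum1_card.
rewrite -sum1_card (exchange_big_dep [in [set S : {set V} | (#|S| == k) &&
   [forall i, #|S :&: fibre i| < k]]]) /=; last first.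
  move=> l S /eqP suml; rewrite !inE => /forallP HS.
  apply/andP; split.
    rewrite -sum_card_fibre -[X in _ == X]suml.
    by apply/eqP/eq_bigr => i _; apply/eqP.
  by apply/forallP => i; rewrite (eqP (HS i)).
apply: eq_bigr => S; rewrite inE => /andP[/eqP cardS /forallP ltS].
pose l0 := [ffun i => Ordinal (ltS i)].
rewrite (big_pred1 l0) // => l; rewrite inE /=.
apply/andP/eqP => [[_ /forallP HS] | ->].
  by apply/ffunP => i; apply: val_inj; rewrite ffunE /= (eqP (HS i)).
split; last by apply/forallP => i; rewrite ffunE.
rewrite -[X in _ == X]cardS -sum_card_fibre.
by apply/eqP; apply: eq_bigr => i _; rewrite ffunE.
Qed.

End Profile.

(** The components of an undirected graph are the fibres of a labelling of
    the vertices. *)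
Lemma component_label (V : finType) (e : rel V) : symmetric e ->
  exists c : V -> 'I_#|components e|,
    (forall i, component i = [set x | c x == i]) /\
    (forall x y, connect e x y = (c x == c y)).
Proof.
move=> /sym_connect_sym esym.
have eqv : {in [set: V] & &, equivalence_rel (connect e)}.
  move=> x y z _ _ _; split; first exact: connect0.
  by move=> /(same_connect esym) ->.
have /and3P[/eqP covP trivP _] := equivalence_partitionP eqv.
have inP x : pblock (components e) x \in components e.
  by rewrite pblock_mem // covP inE.
pose c x := enum_rank_in (inP x) (pblock (components e) x).
have cK x : component (c x) = pblock (components e) x.
  by rewrite /component enum_rankK_in.
exists c; split => [i | x y].
  apply/setP => x; rewrite inE.
  have xi : (x \in component i) = (pblock (components e) x == component i).
    apply/idP/eqP => [xi | <-]; last by rewrite mem_pblock covP inE.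
    by apply: def_pblock => //; apply: enum_valP.
  by rewrite xi -cK; apply: inj_eq enum_val_inj _ _.
rewrite -(inj_eq (@enum_val_inj _ _)) -!/(component _) !cK.
rewrite eq_pblock ?covP ?inE //.
by rewrite (pblock_equivalence_partition eqv) ?inE.
Qed.

(** Also valid when [e] has at most one component: both sides are then 0. *)
Lemma N_separated (V : finType) (e : rel V) (k : nat) : symmetric e -> 0 < k ->
  N k e = #|[set S : {set V} | (#|S| == k) && separated e S]|.
Proof.
move=> esym k_gt0; have [c [compE conE]] := component_label esym.
have sepE (S : {set V}) : #|S| = k ->
    separated e S = [forall i, #|S :&: [set x | c x == i]| < k].
  move=> cardS; apply/idP/forallP => [sepS i | ltS].
    rewrite ltn_neqAle -{2}cardS subset_leq_card ?subsetIl // andbT.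
    apply: contraL sepS => /eqP cardSi; apply/separatedPn.
    have /eqP/setIidPl/subsetP SC : S :&: [set x | c x == i] == S.
      by rewrite eqEcard subsetIl cardSi cardS leqnn.
    move=> x y /SC + /SC; rewrite !inE conE => /eqP-> /eqP->.
    exact: eqxx.
  apply: contraT => /separatedPn conS.
  have /card_gt0P[x xS] : 0 < #|S| by rewrite cardS.
  have := ltS (c x); rewrite (setIidPl _) ?cardS ?ltnn //.
  by apply/subsetP => y yS; rewrite inE -conE conS.
rewrite /N; case: ifPn => [_ | ]; last first.
  rewrite -leqNgt => p_le1; apply/eqP; rewrite eq_sym cards_eq0 -subset0.
  apply/subsetP => S; rewrite inE => /andP[_].
  apply: contraLR => _; apply/separatedPn => x y _ _.
  rewrite conE -val_eqE /=.
  have := leq_trans (ltn_ord (c x)) p_le1.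
  have := leq_trans (ltn_ord (c y)) p_le1.
  by rewrite !ltnS !leqn0 => /eqP-> /eqP->.
under eq_bigr => l _ do under eq_bigr => i _ do rewrite compE.
rewrite sum_profiles; apply: eq_card => S; rewrite !inE.
by case: eqP => //= /sepE ->.
Qed.

(** * Steiner diversity in a tree *)

Section Edges.

Variables (V : finType) (e : rel V).
Hypothesis esym : symmetric e.

Lemma adj_of_edges : adj_of (edges e) =2 e.
Proof.
move=> x y; apply/imsetP/idP => [[[a b] /= eab E] | exy]; last first.
  by exists (x, y); rewrite ?inE.
by rewrite inE /= in eab; case/set2_eq: E => -[-> ->]; rewrite // esym.
Qed.

Lemma edgesP (d : {set V}) :
  d \in edges e -> exists x y, d = [set x; y] /\ e x y.
Proof. by case/imsetP=> -[x y]; rewrite inE /= => exy ->; exists x, y. Qed.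

Lemma del_edge_sym (d : {set V}) : symmetric (del_edge e d).
Proof. by move=> x y; rewrite /del_edge /= esym setUC. Qed.

Lemma acyclic_bridge (x y : V) : irreflexive e -> acyclic e -> e x y ->
  ~~ connect (del_edge e [set x; y]) x y.
Proof.
move=> eirr acyc exy; apply/negP => /connectP[p0 path_p0 lastp0].
move: lastp0; case/shortenP: path_p0 => p path_p uniq_p _ lastp.
have path_e : path e x p by apply: sub_path path_p => u v /andP[].
have size_p : 1 < size p.
  case: p path_p lastp {uniq_p path_e} => [_ E | z [|//] /= + /= E].
    by rewrite E /= eirr in exy.
  by rewrite /del_edge /= -E eqxx andbF.
apply: (acyc (x :: p)) => //.
by rewrite /ucycle uniq_p andbT /= rcons_path path_e -lastp esym.
Qed.

Lemma connect_del_edge (x y z : V) : connected_on e [set: V] ->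
  connect (del_edge e [set x; y]) x z || connect (del_edge e [set x; y]) y z.
Proof.
move=> /andP[_ /forall_inP conV].
set g := del_edge e _.
pose A := [pred u | connect g x u || connect g y u].
have clA : closed e A.
  apply: intro_closed; first exact: sym_connect_sym.
  move=> u v euv; rewrite !inE.
  case: (eqVneq [set u; v] [set x; y]) => [/set2_eq[] [_ ->] _ | ne].
  - by rewrite connect0 orbT.
  - by rewrite connect0.
  have /connect1 guv : g u v by rewrite /g /del_edge /= euv.
  by case/orP => /connect_trans/(_ guv)->; rewrite ?orbT.
have /forall_inP/(_ z (in_setT z)) conxz := conV x (in_setT x).
have := closed_connect clA conxz.
by rewrite !inE connect0.
Qed.

Lemma subgraphT : connected_on e [set: V] ->
  connected_subgraph e ([set: V], edges e).
Proof.
move=> /andP[V0 conV]; apply/andP; split.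
  by rewrite /subgraph subxx; apply/forall_inP => d _; apply: subsetT.
apply/andP; split => //.
apply/forall_inP => x xV; apply/forall_inP => y yV.
rewrite (eq_connect adj_of_edges).
by have /forall_inP/(_ x xV)/forall_inP/(_ y yV) := conV.
Qed.

Lemma separated_sub (H : {set V} * {set {set V}}) (S d : {set V}) :
  connected_subgraph e H -> S \subset H.1 ->
  separated (del_edge e d) S -> d \in H.2.
Proof.
move=> /andP[/andP[subE _] /andP[_ /forall_inP conH]] /subsetP SH.
apply: contraLR => dH; apply/separatedPn => x y /SH xH /SH yH.
have /forall_inP/(_ y yH) := conH x xH; apply: connect_sub => u v uv.
have euv : e u v by rewrite -adj_of_edges; apply: (subsetP subE).
apply: connect1; rewrite /del_edge /= euv /=.
by apply: contraNneq dH => <-.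
Qed.

(** Cutting a connected subgraph down to the side of a bridge [x y] that
    contains [x] and [S]. *)
Lemma prune (H : {set V} * {set {set V}}) (S : {set V}) (x y : V) :
  connected_subgraph e H -> S \subset H.1 -> S != set0 ->
  [set x; y] \in H.2 ->
  ~~ connect (del_edge e [set x; y]) x y ->
  {in S, forall z, connect (del_edge e [set x; y]) x z} ->
  exists H', [/\ connected_subgraph e H', S \subset H'.1 & #|H'.2| < #|H.2|].
Proof.
move=> /andP[/andP[/subsetP subE /forall_inP inH] /andP[_ /forall_inP conH]].
move=> /subsetP SH /set0Pn[s sS] xyH bridge SC.
pose C := [set z | connect (del_edge e [set x; y]) x z].
pose H' := (H.1 :&: C, [set d in H.2 | d \subset C]).
have SH' : S \subset H'.1.
  by apply/subsetP => z zS; rewrite inE SH //= inE SC.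
have ltH : #|H'.2| < #|H.2|.
  apply/proper_card/properP; split.
    by apply/subsetP => d; rewrite inE => /andP[].
  exists [set x; y] => //; rewrite inE xyH /=.
  by apply: contra bridge => /subsetP/(_ y); rewrite set22 inE => ->.
exists H'; split=> //; apply/andP; split.
  apply/andP; split; first by apply/subsetP => d; rewrite inE => /andP[/subE].
  by apply/forall_inP=> d; rewrite inE => /andP[dH dC]; rewrite subsetI inH.
apply/andP; split; first by apply/set0Pn; exists s; apply: (subsetP SH').
(* Retraction of the vertices onto the component [C]. *)
pose r z := if z \in C then z else x.
have xC : x \in C by rewrite inE connect0.
(* Only the edge [x y] leaves [C]; its outer end is sent to its inner end. *)
have leave u v : [set u; v] \in H.2 -> u \in C -> v \notin C -> u = x.
  move=> uvH; rewrite !inE => xu xv.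
  have euv : e u v by rewrite -adj_of_edges; apply: subE.
  case: (eqVneq [set u; v] [set x; y]) => [/set2_eq[] [uE vE]|ne] //.
    by rewrite vE connect0 in xv.
  case/negP: xv; apply: connect_trans xu (connect1 _).
  by rewrite /del_edge /= euv.
have retract u v :
    connect (adj_of H.2) u v -> connect (adj_of H'.2) (r u) (r v).
  case/connectP => p; elim: p u => [u _ -> | w p IH u /= /andP[uw pw] lastv].
    exact: connect0.
  apply: connect_trans (IH w pw lastv).
  rewrite /r; case: ifPn => uC; case: ifPn => wC; last exact: connect0.
  - by apply: connect1; rewrite /adj_of /= inE (uw : [set u; w] \in H.2)
      subUset !sub1set uC wC.
  - by rewrite (leave u w uw uC wC).
  - by rewrite (leave w u _ wC uC) // setUC.
apply/forall_inP => u /setIP[uH uC]; apply/forall_inP => v /setIP[vH vC].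
have /forall_inP/(_ v vH)/retract := conH u uH.
by rewrite /r uC vC.
Qed.

End Edges.

Lemma steiner_tree (V : finType) (e : rel V) (S : {set V}) :
  is_tree e -> S != set0 ->
  steiner e S = #|[set d in edges e | separated (del_edge e d) S]|.
Proof.
move=> [[esym eirr] conV acyc] S0; rewrite /steiner.
case: arg_minnP => [|H /andP[conH SH] minH].
  by rewrite subgraphT // subsetT.
congr #|pred_of_set _|; apply/setP => d; rewrite inE.
apply/idP/andP => [dH | [_ /(separated_sub esym conH SH)//]].
have dE : d \in edges e by case/andP: conH => /andP[/subsetP/(_ d dH)].
split=> //; apply: contraT => /separatedPn conS.
(* If all of S lay on one side of d, pruning would contradict minimality. *)
have side x y : d = [set x; y] -> e x y ->
    {in S, forall z, connect (del_edge e d) x z} -> False.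
  move=> dxy exy; rewrite dxy in dH * => xS.
  have bridge := acyclic_bridge esym eirr acyc exy.
  have [H' [conH' SH' ltH']] := prune esym conH SH S0 dH bridge xS.
  by have := minH H'; rewrite conH' SH' leqNgt ltH' => /(_ isT).
have [x [y [dxy exy]]] := edgesP dE.
have /set0Pn[s sS] := S0.
exfalso; have := connect_del_edge esym x y s conV; rewrite -dxy => /orP[] ds.
  by apply: (side x y) => // z /(conS s z sS); apply: connect_trans.
apply: (side y x) => [||z /(conS s z sS)]; first by rewrite setUC.
  by rewrite esym.
exact: connect_trans.
Qed.

(** * Exchanging the sums over sets and edges *)

Theorem theorem1 (V : finType) (e : rel V) (k : nat) :
  is_tree e -> 2 <= k ->
  SW e k = \sum_(d in edges e) N k (del_edge e d).
Proof.
move=> treee k_ge2; have k_gt0 := ltnW k_ge2.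
have esym : symmetric e by case: treee => -[].
transitivity (\sum_(S : {set V} | #|S| == k)
                \sum_(d in edges e | separated (del_edge e d) S) 1).
  apply: eq_bigr => S /eqP cardS.
  rewrite steiner_tree // -?card_gt0 ?cardS // -sum1_card.
  by apply: eq_bigl => d; rewrite inE.
rewrite (exchange_big_dep [in edges e]) /=; last by move=> S d _ /andP[].
apply: eq_bigr => d dE; rewrite (N_separated (del_edge_sym esym d)) //.
by rewrite -sum1_card; apply: eq_bigl => S; rewrite inE dE.
Qed.
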